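(* Let $\mathcal{L},\mathcal{L}'$ be finite lattices. If $\mathcal{B}$ is a connected $\mathcal{L}$-building set and $\mathcal{B}'$ is a connected $\mathcal{L}'$-building set, then $$\mathcal{B}\boxplus\mathcal{B}'=\bigl((\mathcal{B}\setminus\{\hat 1_{\mathcal{L}}\})\times\{\hat 0_{\mathcal{L}'}\}\bigr)\sqcup\bigl(\{\hat 0_{\mathcal{L}}\}\times(\mathcal{B}'\setminus\{\hat 1_{\mathcal{L}'}\})\bigr)\sqcup\{\hat 1_{\mathcal{L}\boxtimes\mathcal{L}'}\}$$ is a connected $(\mathcal{L}\boxtimes\mathcal{L}')$-building set, whose $(\mathcal{L}\boxtimes\mathcal{L}')$-nested complex is isomorphic to the join of the $\mathcal{L}$-nested complex of $\mathcal{B}$ and the $\mathcal{L}'$-nested complex of $\mathcal{B}'$.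
   Context: The free product $\mathcal{L}\boxtimes\mathcal{L}'$ of two finite lattices is the lattice obtained from the Cartesian product $(\mathcal{L}\setminus\{\hat 1_{\mathcal{L}}\})\times(\mathcal{L}'\setminus\{\hat 1_{\mathcal{L}'}\})$ (componentwise order) by adding a top element $\hat 1_{\mathcal{L}\boxtimes\mathcal{L}'}$. For a finite lattice $\mathcal{L}$ with bottom $\hat 0$ and top $\hat 1$, an $\mathcal{L}$-building set is a subset $\mathcal{B}\subseteq\mathcal{L}_{>\hat 0}$ such that for every $Y\in\mathcal{L}_{>\hat 0}$, with $\{B_1,\dots,B_k\}=\max(\mathcal{B}_{\le Y})$, there is a poset isomorphism $\prod_{j}\mathcal{L}_{\le B_j}\to\mathcal{L}_{\le Y}$ whose $j$-th component is the inclusion. Let $\kappa(\mathcal{B})=\max(\mathcal{B})$; $\mathcal{B}$ is connected if $|\kappa(\mathcal{B})|=1$. An $\mathcal{L}$-nested set on $\mathcal{B}$ is a subset $\mathcal{N}\subseteq\mathcal{B}$ containing $\kappa(\mathcal{B})$ such that for any $k\ge2$ pairwise incomparable $B_1,\dots,B_k\in\mathcal{N}\setminus\kappa(\mathcal{B})$, the join $B_1\vee\cdots\vee B_k$ is not in $\mathcal{B}$. The $\mathcal{L}$-nested complex of $\mathcal{B}$ is the simplicial complex with faces $\mathcal{N}\setminus\kappa(\mathcal{B})$. The join of simplicial complexes $\Delta$ and $\Delta'$ is $\{\sigma\sqcup\sigma':\sigma\in\Delta,\sigma'\in\Delta'\}$. *)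

(* Defs.v *)
From HB Require Import structures.
From mathcomp Require Import all_boot all_order.

Set Implicit Arguments.
Unset Strict Implicit.
Unset Printing Implicit Defensive.

Import Order.TTheory.
Local Open Scope order_scope.

Definition poset_iso (T U : Type) (leT : rel T) (leU : rel U) (f : T -> U) :=
  bijective f /\ (forall x y, leU (f x) (f y) = leT x y).

Section BuildingSets.
Context (d : Order.disp_t) (L : finTBLatticeType d).
Implicit Types (A B N : {set L}) (Y : L).

Definition downset Y := {x : L | x <= Y}.

Definition le_downset Y : rel (downset Y) := fun x y => val x <= val y.

Definition below B Y : {set L} := [set b in B | b <= Y].

Definition maximals A : {set L} :=
  [set b in A | [forall c in A, (b <= c) ==> (c == b)]].

Definition elements A := {b : L | b \in A}.

Definition prod_downset A := {dffun forall j : elements A, downset (val j)}.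

Definition le_prod_downset A : rel (prod_downset A) :=
  fun f g => [forall j, le_downset (f j) (g j)].

(* The j-th axis of the product consists of the tuples whose coordinates other
   than j are \bot; the last clause says that phi sends the point of that axis
   with j-th coordinate x to x itself. *)
Definition building_set B : Prop :=
  (forall b, b \in B -> \bot < b) /\
  (forall Y, \bot < Y ->
    exists phi : prod_downset (maximals (below B Y)) -> downset Y,
      poset_iso (@le_prod_downset _) (@le_downset Y) phi /\
      (forall (j : elements (maximals (below B Y)))
              (f : prod_downset (maximals (below B Y))),
         (forall i, i != j -> val (f i) = \bot) -> val (phi f) = val (f j))).

Definition kappa B : {set L} := maximals B.

Definition connected_building B : bool := #|kappa B| == 1%N.

Definition antichain A : bool :=
  [forall x in A, forall y in A, (x != y) ==> ~~ (x >=< y)].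

Definition nested_set B N : bool :=
  [&& N \subset B, kappa B \subset N &
    [forall A : {set L},
      [&& A \subset N :\: kappa B, (2 <= #|A|)%N & antichain A] ==>
      ((\join_(b in A) b) \notin B)]].

End BuildingSets.

Record simplicial_complex (V : finType) := SimplicialComplex {
  faces : {set {set V}};
  faces_set0 : set0 \in faces;
  faces_sub : forall s t : {set V}, s \subset t -> t \in faces -> s \in faces
}.

Definition vertices (V : finType) (D : simplicial_complex V) : {set V} :=
  [set v | [set v] \in faces D].

Section SimplicialComplexes.
Context (V W : finType).

Definition join_faces (D : simplicial_complex V) (E : simplicial_complex W) :
    {set {set V + W}} :=
  [set (@inl V W) @: s :|: (@inr V W) @: t 
     | s : {set V} in faces D, t : {set W} in faces E].

Lemma join_faces_set0 D E : set0 \in join_faces D E.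
Proof.
by apply/imset2P; exists set0 set0; rewrite ?faces_set0 // !imset0 setU0.
Qed.

Lemma join_faces_sub D E (s t : {set V + W}) :
  s \subset t -> t \in join_faces D E -> s \in join_faces D E.
Proof.
move=> sst /imset2P[a b aD bE def_t]; apply/imset2P.
exists ((@inl V W) @^-1: s) ((@inr V W) @^-1: s).
- apply: faces_sub aD; apply/subsetP => x; rewrite inE => /(subsetP sst).
  by rewrite def_t inE => /orP[] /imsetP[y yP] // [->].
- apply: faces_sub bE; apply/subsetP => x; rewrite inE => /(subsetP sst).
  by rewrite def_t inE => /orP[] /imsetP[y yP] // [->].
apply/setP => z; rewrite inE; apply/idP/orP.
  by case: z => z zs; [left | right]; apply: imset_f; rewrite inE.
by case=> /imsetP[y]; rewrite inE => ys ->.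
Qed.

Definition simplicial_join D E : simplicial_complex (V + W)%type :=
  SimplicialComplex (join_faces_set0 D E) (@join_faces_sub D E).

Definition simplicial_iso
    (D : simplicial_complex V) (E : simplicial_complex W) : Prop :=
  exists f : {v : V | v \in vertices D} -> {w : W | w \in vertices E},
    bijective f /\
    (forall s : {set {v : V | v \in vertices D}},
       ([set val (f v) | v in s] \in faces E) =
       ([set val v | v in s] \in faces D)).

End SimplicialComplexes.

Section NestedComplex.
Context (d : Order.disp_t) (L : finTBLatticeType d) (B : {set L}).

Definition nested_faces : {set {set L}} :=
  [set N :\: kappa B | N in [set N : {set L} | nested_set B N]].

Lemma kappa_sub : kappa B \subset B.
Proof. by apply/subsetP => x; rewrite inE => /andP[]. Qed.

Lemma nested_faces_set0 : set0 \in nested_faces.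
Proof.
apply/imsetP; exists (kappa B); last by rewrite setDv.
rewrite inE /nested_set kappa_sub subxx /=.
apply/forallP => A; apply/implyP => /and3P[].
by rewrite setDv subset0 => /eqP->; rewrite cards0.
Qed.

Lemma nested_faces_sub (s t : {set L}) :
  s \subset t -> t \in nested_faces -> s \in nested_faces.
Proof.
move=> sst /imsetP[N]; rewrite inE => /and3P[NB kN /forallP nN] def_t.
have sNk : s \subset N :\: kappa B by rewrite -def_t.
have sK : (s :|: kappa B) :\: kappa B = s.
  rewrite setDUl setDv setU0; apply/setDidPl.
  by have := sNk; rewrite subsetD => /andP[].
apply/imsetP; exists (s :|: kappa B); last by rewrite sK.
rewrite inE /nested_set subUset kappa_sub subsetUr sK andbT.
rewrite (subset_trans sNk (subset_trans (subsetDl _ _) NB)) /=.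
apply/forallP => A; apply/implyP => /and3P[As cA aA].
by apply: (implyP (nN A)); rewrite (subset_trans As sNk) cA aA.
Qed.

Definition nested_complex : simplicial_complex L :=
  SimplicialComplex nested_faces_set0 nested_faces_sub.

End NestedComplex.

Fact free_prod_display (d d' : Order.disp_t) : Order.disp_t.
Proof. exact: d. Qed.

Section FreeProduct.
Context (d d' : Order.disp_t) (L : finTBLatticeType d) (L' : finTBLatticeType d').

Definition proper_pair := {p : L *p L' | (p.1 != \top) && (p.2 != \top)}.

(* None is the added top element. *)
Definition free_prod := option proper_pair.

HB.instance Definition _ := Finite.on free_prod.

(* The class of (x, y): (x, y) itself if x and y are both different from \top,
   the added top otherwise. *)
Definition free_pair (x : L) (y : L') : free_prod := insub (x, y).

Definition free_le (u v : free_prod) : bool :=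
  match u, v with
  | _, None => true
  | None, Some _ => false
  | Some p, Some q => val p <= val q
  end.

Definition free_meet (u v : free_prod) : free_prod :=
  match u, v with
  | None, _ => v
  | _, None => u
  | Some p, Some q => insub (val p `&` val q)
  end.

Definition free_join (u v : free_prod) : free_prod :=
  match u, v with
  | Some p, Some q => insub (val p `|` val q)
  | _, _ => None
  end.

Lemma free_le_refl : reflexive free_le.
Proof. by case=> [p|] /=. Qed.

Lemma free_le_anti : antisymmetric free_le.
Proof. by case=> [p|] [q|] //= /le_anti/val_inj->. Qed.

Lemma free_le_trans : transitive free_le.
Proof. by case=> [p|] [q|] [r|] //=; apply: le_trans. Qed.

HB.instance Definition _ := Order.Le_isPOrder.Build (free_prod_display d d')
  free_prod free_le_refl free_le_anti free_le_trans.

Lemma proper_pairP (p q : L *p L') :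
  p <= q -> (q.1 != \top) && (q.2 != \top) -> (p.1 != \top) && (p.2 != \top).
Proof.
move=> /andP[le1 le2] /andP[n1 n2]; apply/andP; split.
  by apply: contraNneq n1 => e; move: le1; rewrite e le1x.
by apply: contraNneq n2 => e; move: le2; rewrite e le1x.
Qed.

Lemma free_meetP (u v w : free_prod) :
  (u <= free_meet v w) = (u <= v) && (u <= w).
Proof.
rewrite /Order.le /=; case: v w u => [p|] [q|] [r|] //=; rewrite ?andbT //.
  rewrite insubT; first exact: (proper_pairP (leIl _ _) (valP p)).
  by move=> h /=; rewrite -lexI.
by rewrite insubT //; exact: (proper_pairP (leIl _ _) (valP p)).
Qed.

Lemma free_joinP (u v w : free_prod) :
  (free_join u v <= w) = (u <= w) && (v <= w).
Proof.
rewrite /Order.le /=; case: u v w => [p|] [q|] [r|] //=; rewrite ?andbF //.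
  case: insubP => [s _ es | np] /=; first by rewrite es leUx.
  apply/esym/negbTE; apply: contra np; rewrite -leUx => ler.
  exact: proper_pairP ler (valP r).
by case: insubP.
Qed.

Lemma free_le0 (u : free_prod) : free_pair \bot \bot <= u.
Proof.
rewrite /free_pair; case: u => [p|]; rewrite /Order.le /=.
  have le0p : ((\bot, \bot) : L *p L') <= val p by apply: le0x.
  by rewrite insubT; [exact: proper_pairP le0p (valP p) | move=> h].
by case: insubP.
Qed.

Lemma free_le1 (u : free_prod) : u <= None.
Proof. by case: u. Qed.

HB.instance Definition _ := Order.POrder_MeetJoin_isLattice.Build
  (free_prod_display d d') free_prod free_meetP free_joinP.
HB.instance Definition _ := Order.hasBottom.Build
  (free_prod_display d d') free_prod free_le0.
HB.instance Definition _ := Order.hasTop.Build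
  (free_prod_display d d') free_prod free_le1.

Definition boxplus (B : {set L}) (B' : {set L'}) : {set free_prod} :=
  [set free_pair b \bot | b in B :\ \top] :|:
  [set free_pair \bot b' | b' in B' :\ \top] :|:
  [set \top].

End FreeProduct.

Arguments free_prod {d d'} L L'.

(* Main.v *)
Require Import Defs.
From mathcomp Require Import all_boot all_order.

(** The proof rests on two reformulations, after which everything can be
    computed coordinatewise.

    The isomorphism required of a building set is forced: it must send a tuple
    to the join of its entries, and its inverse must send x to the tuple of the
    x /\ b, for b a factor. So its existence is a statement [splits M Y] about
    meets and bounds in the lattice, with no product type
    ([splits_of_iso], [iso_of_splits]).

    The free product is a reflective subposet of the Cartesian product: it embeds
    by the projections [free_fst], [free_snd] that send the added top to
    (\top, \top), and [free_pair] is left adjoint to this embedding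
    ([free_pair_le]). Hence order and meets in the free product are
    computed in the two factors, and joins are computed there and then pushed
    forward ([free_leE], [free_fstI], [free_pairU], [join_inj]).

    A proper element (x, y) has below it, in the boxplus, the elements of B
    below x on one axis and the elements of B' below y on the other. No nonzero
    element of one axis lies below an element of the other, so the maximal ones
    are those of x and those of y, and the decompositions of x and y combine
    ([splits_inj]).

    For nested sets, connectedness makes \top the only maximal element on both
    sides. An antichain in the boxplus without its top is a union of an
    antichain A1 on the first axis and an antichain A2 on the second, with join
    the class of (\join A1, \join A2). If A1 and A2 lie in nested sets without
    their tops, neither join is
    \top; the class can then be in the boxplus only on one of the axes, which
    forces A1 or A2 to be empty and reduces to one factor
    ([nested_boxplus_inj]). The vertex correspondence is the evident one between
    the disjoint union of B and B' without their tops and the boxplus without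
    its top. *)

Set Implicit Arguments.
Unset Strict Implicit.
Unset Printing Implicit Defensive.

Import Order.TTheory.
Local Open Scope order_scope.

(** * Building sets without product types *)

Section Splitting.
Context (d : Order.disp_t) (L : finTBLatticeType d).
Implicit Types (A B M S : {set L}) (x y w z b Y : L).

(** The internal form of the isomorphism between the product of the intervals
    below the elements of M and the interval below Y: the first clause says that
    x is the join of its coordinates x /\ b, the second that every tuple f is
    the coordinate tuple of some z. Bounds replace joins so that both clauses
    transfer through [free_pair_le]. *)
Definition splits M Y : Prop :=
  (forall x w, x <= Y -> (forall b, b \in M -> x `&` b <= w) -> x <= w) /\
  (forall f : L -> L, (forall b, b \in M -> f b <= b) ->
    exists z, [/\ z <= Y, forall b, b \in M -> f b <= z &
                  forall b, b \in M -> z `&` b <= f b]).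

(** Meeting with the bound makes every family of elements of L into a tuple,
    so that axis points can be written by a plain case distinction on indices. *)
Definition coords M (g : elements M -> L) : prod_downset M :=
  [ffun j => exist (fun x => x <= val j) (g j `&` val j) (leIr _ _)].

Lemma val_coords M (g : elements M -> L) j : val (coords g j) = g j `&` val j.
Proof. by rewrite ffunE. Qed.

Lemma le_prod_downsetP M (f g : prod_downset M) :
  reflect (forall j, val (f j) <= val (g j)) (le_prod_downset f g).
Proof. exact: forallP. Qed.

(** An element x below b_j lies below phi f exactly when the axis point of x lies
    below f, that is, when x is below f_j. This determines the coordinates of
    phi f as its meets with the b_j. *)
Lemma splits_of_iso M Y (phi : prod_downset M -> downset Y) :
    (forall b, b \in M -> b <= Y) ->
    poset_iso (@le_prod_downset _ _ _) (@le_downset _ _ Y) phi ->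
    (forall (j : elements M) (f : prod_downset M),
      (forall i, i != j -> val (f i) = \bot) -> val (phi f) = val (f j)) ->
  splits M Y.
Proof.
move=> MY [[psi phiK psiK] phi_le] phi_axis.
have le_phi f g : (val (phi f) <= val (phi g)) = le_prod_downset f g.
  exact: phi_le.
pose axis (j : elements M) x := coords (fun i => if i == j then x else \bot).
have phi_axisE j x : x <= val j -> val (phi (axis j x)) = x.
  move=> xj; rewrite (phi_axis j) => [|i /negbTE ij].
    by rewrite val_coords eqxx; apply/meet_idPl.
  by rewrite val_coords ij meet0x.
have axis_le j x f : x <= val j ->
    (x <= val (phi f)) = (x <= val (f j)).
  move=> xj; rewrite -{1}(phi_axisE j x xj) le_phi.
  apply/le_prod_downsetP/idP => [/(_ j)|xf i].
    by rewrite val_coords eqxx (meet_idPl xj).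
  rewrite val_coords; case: eqP => [->|_]; last by rewrite meet0x le0x.
  by rewrite (meet_idPl xj).
split=> [x w xY le_w|f fM].
  pose X : downset Y := exist _ x xY.
  have XE : val (phi (psi X)) = x by rewrite psiK.
  pose W : downset Y := exist _ (w `&` Y) (leIr _ _).
  have WE : val (phi (psi W)) = w `&` Y by rewrite psiK.
  suff : x <= w `&` Y by rewrite lexI => /andP[].
  rewrite -XE -WE le_phi; apply/le_prod_downsetP => j.
  rewrite -(axis_le j _ _ (valP (psi X j))) WE lexI.
  rewrite (le_trans (valP (psi X j)) (MY (val j) (valP j))) andbT.
  have := le_w (val j) (valP j); apply: le_trans.
  rewrite lexI (valP (psi X j)) andbT.
  by rewrite -[leRHS]XE (axis_le j _ _ (valP (psi X j))).
pose F : prod_downset M := coords (fun j => f (val j)).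
have FE j : val (F j) = f (val j).
  by rewrite val_coords; apply/meet_idPl/fM/valP.
exists (val (phi F)); split=> [|b bM|b bM]; first exact: (valP (phi F)).
  by have := axis_le (exist _ b bM) (f b) F (fM _ bM); rewrite FE /= lexx.
have := axis_le (exist _ b bM) (val (phi F) `&` b) F (leIr _ _).
by rewrite FE /= leIl => <-.
Qed.

(** The isomorphism is the join of the coordinates; the second clause of
    [splits] says that meeting with b_j recovers f_j, since this join lies below
    any z that bounds the f_j. *)
Lemma iso_of_splits M Y :
    (forall b, b \in M -> b <= Y) -> splits M Y ->
  exists phi : prod_downset M -> downset Y,
    poset_iso (@le_prod_downset _ _ _) (@le_downset _ _ Y) phi /\
    (forall (j : elements M) (f : prod_downset M),
      (forall i, i != j -> val (f i) = \bot) -> val (phi f) = val (f j)).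
Proof.
move=> MY [split1 split2].
have joinY (f : prod_downset M) : \join_j val (f j) <= Y.
  by apply/joinsP => j _; apply: le_trans (valP (f j)) (MY (val j) (valP j)).
pose phi f : downset Y := exist (fun x => x <= Y) _ (joinY f).
have phi_coord f j : val (phi f) `&` val j = val (f j).
  pose F b := if insub b is Some j then val (f j) else \bot.
  have FE i : F (val i) = val (f i) by rewrite /F valK.
  have [b bM|z [_ Fz zF]] := split2 F.
    have -> : b = val (exist _ b bM : elements M) by [].
    by rewrite FE; exact: (valP (f _)).
  apply/le_anti; rewrite lexI (valP (f j)) andbT.
  rewrite (joins_sup (fun j => val (f j))) ?andbT //=.
  rewrite -FE; have := zF _ (valP j); apply: le_trans; apply: leI2 => //.
  by apply/joinsP => i _; rewrite -FE; apply/Fz/valP.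
pose psi (X : downset Y) : prod_downset M := coords (fun=> val X).
exists phi; split; first split.
- exists psi => [f|X].
    by apply/ffunP => j; apply: val_inj; rewrite val_coords phi_coord.
  apply: val_inj; apply/le_anti/andP; split.
    by apply/joinsP => j _; rewrite val_coords leIl.
  apply: split1 (valP X) _ => b bM.
  apply: (joins_min (j := exist _ b bM : elements M)) => //.
  by rewrite val_coords.
- move=> f g; apply/idP/le_prod_downsetP => [fg j|fg].
    by rewrite -!phi_coord; apply: leI2.
  apply/joinsP => j _; apply: le_trans (fg j) _.
  exact: (joins_sup (fun j => val (g j))).
move=> j f f0; apply/le_anti/andP; split; last first.
  exact: (joins_sup (fun j => val (f j))).
apply/joinsP => i _; have [->//|/f0->] := eqVneq i j; exact: le0x.
Qed.

Lemma maximalsP A b :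
  reflect (b \in A /\ forall c, c \in A -> b <= c -> c = b) (b \in maximals A).
Proof.
rewrite inE; apply: (iffP andP) => -[bA max]; split=> //.
  by move=> c cA bc; apply/eqP; have /forall_inP/(_ c cA)/implyP := max; apply.
by apply/forall_inP => c cA; apply/implyP => /(max c cA)->.
Qed.

Lemma below_le B Y b : b \in maximals (below B Y) -> b <= Y.
Proof. by rewrite !inE => /andP[/andP[]]. Qed.

(** The case Y = \bot is included because one component of a nonzero pair may
    vanish. *)
Lemma building_splits B Y : building_set B -> splits (maximals (below B Y)) Y.
Proof.
move=> [B_gt0 /(_ Y)]; rewrite lt0x; case: eqP => [-> _|_ /(_ isT)[phi [iso ax]]].
  split=> [x w + _|f _]; first by rewrite lex0 => /eqP->; exact: le0x.
  exists \bot; split=> // b; rewrite !inE lex0 => /andP[/andP[bB /eqP b0]];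
  by have := B_gt0 _ bB; rewrite b0 ltxx.
exact: splits_of_iso (@below_le B Y) iso ax.
Qed.

Lemma building_of_splits B :
    (forall b, b \in B -> \bot < b) ->
    (forall Y, \bot < Y -> splits (maximals (below B Y)) Y) ->
  building_set B.
Proof.
move=> B_gt0 B_split; split=> // Y Y0.
exact: iso_of_splits (@below_le B Y) (B_split Y Y0).
Qed.

(** For Y = \top there is a single factor, the maximal element m, so the
    splitting says that \top is its own meet with m. *)
Lemma kappa_connected B :
  building_set B -> connected_building B -> kappa B = [set \top].
Proof.
move=> hB /cards1P[m Bm].
have BT : below B \top = B by apply/setP => x; rewrite inE lex1 andbT.
have := building_splits \top hB; rewrite BT -[maximals B]/(kappa B) Bm.
case=> /(_ \top m (lex1 _)) top_m _.
congr [set _]; apply/eqP; rewrite -le1x; apply: top_m => b.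
by rewrite inE => /eqP->; exact: leIr.
Qed.

Lemma splits1 Y : splits [set Y] Y.
Proof.
split=> [x w xY /(_ Y)|f fY].
  by rewrite inE eqxx (meet_idPl xY); apply.
by exists (f Y); split=> [|b|b]; rewrite ?fY ?inE // => /eqP->; rewrite ?leIl.
Qed.

Lemma top_kappa B : \top \in B -> kappa B = [set \top].
Proof.
move=> BT; apply/setP => x; rewrite !inE; apply/andP/eqP => [[xB]|->].
  by move=> /forall_inP/(_ _ BT); rewrite lex1 => /eqP.
by split=> //; apply/forall_inP => y _; rewrite le1x implybb.
Qed.

End Splitting.

(** * Faces of the nested complex *)

Section NestedFaces.
Context (d : Order.disp_t) (L : finTBLatticeType d).
Implicit Types (A B S : {set L}).

Lemma nested_facesP B S :
  reflect (S \subset B :\: kappa B /\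
    forall A, A \subset S -> (2 <= #|A|)%N -> antichain A ->
      \join_(b in A) b \notin B)
    (S \in nested_faces B).
Proof.
apply: (iffP imsetP) => [[N]|[SB Sn]].
  rewrite inE => /and3P[NB kN /forallP nN] ->.
  by split=> [|A AS cA aA]; [exact: setSD | apply: (implyP (nN A)); rewrite AS cA].
have [SB' dS] : S \subset B /\ [disjoint S & kappa B].
  by apply/andP; rewrite -subsetD.
have SK : (S :|: kappa B) :\: kappa B = S.
  by rewrite setDUl setDv setU0; apply/setDidPl.
exists (S :|: kappa B); rewrite ?SK // inE /nested_set SK subUset SB' kappa_sub.
rewrite subsetUr; apply/forallP => A; apply/implyP => /and3P[]; exact: Sn.
Qed.

Lemma antichainP A :
  reflect {in A &, forall x y, x != y -> ~~ (x >=< y)} (antichain A).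
Proof.
apply: (iffP forall_inP) => [hA x y xA yA|hA x xA].
  by have /forall_inP/(_ _ yA)/implyP := hA _ xA.
by apply/forall_inP => y yA; apply/implyP; apply: hA.
Qed.

Lemma antichainS A S : A \subset S -> antichain S -> antichain A.
Proof.
move=> /subsetP AS /antichainP aS.
by apply/antichainP => x y /AS xS /AS yS; apply: aS.
Qed.

Section FaceAntichain.
Context (B S A : {set L}).
Hypotheses (kB : kappa B = [set \top]) (S_face : S \in nested_faces B).
Hypotheses (AS : A \subset S) (A_anti : antichain A).

Lemma face_antichain_building : \join_(b in A) b \in B -> (#|A| <= 1)%N.
Proof.
have [_ Sn] := nested_facesP B S S_face.
move=> jB; rewrite leqNgt; apply/negP => cA.
by have := Sn _ AS cA A_anti; rewrite jB.
Qed.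

(** A join equal to \top would belong to B, so that the antichain would have at
    most one element; but that element is different from \top. *)
Lemma face_antichain_top : (\bot : L) != \top -> \join_(b in A) b != \top.
Proof.
move=> nt; apply/eqP => jT.
have : (#|A| <= 1)%N.
  apply: face_antichain_building; rewrite jT.
  by apply: (subsetP (kappa_sub B)); rewrite kB inE.
case: (posnP #|A|) => [/cards0_eq A0|A_gt0 A_le1].
  by move: nt; rewrite -jT A0 big_set0 eqxx.
have /cards1P[a Aa] : #|A| == 1%N by rewrite eqn_leq A_le1.
have [/subsetP/(_ a) + _] := nested_facesP B S S_face.
move: AS jT; rewrite Aa sub1set big_set1 => -> aT /(_ isT).
by rewrite kB aT !inE eqxx.
Qed.

Lemma face_antichain_bot :
  (forall b, b \in B -> \bot < b) -> \join_(b in A) b = \bot -> A = set0.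
Proof.
move=> B_gt0 j0; apply/setP => a; rewrite inE; apply/negP => aA.
have [/subsetP/(_ a (subsetP AS a aA)) + _] := nested_facesP B S S_face.
have : a <= \bot by rewrite -j0; exact: (joins_sup id).
by rewrite lex0 => /eqP->; rewrite inE => /andP[_ /B_gt0]; rewrite ltxx.
Qed.

End FaceAntichain.

End NestedFaces.

(** * Transport of faces *)

Section Embedding.
Context (d e : Order.disp_t) (L : finTBLatticeType d) (K : finTBLatticeType e).
Implicit Types (j : L -> K) (A S : {set L}).

Lemma antichain_imset j A :
  {in A &, {mono j : x y / x <= y}} -> antichain (j @: A) = antichain A.
Proof.
move=> j_mono; have comp_j : {in A &, forall x y, (j x >=< j y) = (x >=< y)}.
  by move=> x y xA yA; rewrite /Order.comparable !j_mono.
apply/antichainP/antichainP => anti => [x y xA yA nxy|].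
  rewrite -comp_j // anti ?imset_f //.
  by rewrite (inj_in_eq (inc_inj_in j_mono)).
move=> _ _ /imsetP[x xA ->] /imsetP[y yA ->] nxy.
by rewrite comp_j // anti //; apply: contraNneq nxy => ->.
Qed.

(** An order embedding preserves antichains and their sizes, so by the
    assumption on joins the image of an antichain of S with join in B is an
    antichain of j @: S with join in C. *)
Lemma nested_faces_preim (B : {set L}) (C : {set K}) j S :
    S \subset B :\: kappa B -> {in S &, {mono j : x y / x <= y}} ->
    (forall A, A \subset S -> \join_(b in A) b \in B ->
       \join_(c in j @: A) c \in C) ->
  j @: S \in nested_faces C -> S \in nested_faces B.
Proof.
move=> SB j_mono j_join /nested_facesP[_ jS_nested].
apply/nested_facesP; split=> // A AS cA aA.
have j_monoA : {in A &, {mono j : x y / x <= y}}.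
  exact: (sub_in2 (subsetP AS)) j_mono.
apply: contra (j_join A AS) _; apply: jS_nested; first exact: imsetS.
  by rewrite card_in_imset //; exact: inc_inj_in.
by rewrite antichain_imset.
Qed.

End Embedding.

(** Asking the face condition of all sets t, rather than of sets of vertices of
    E, is what makes g send vertices to vertices. *)
Lemma simplicial_iso_of_maps (V W : finType)
    (D : simplicial_complex V) (E : simplicial_complex W)
    (g : V -> W) (h : W -> V) :
    {in vertices D, cancel g h} -> {in vertices E, cancel h g} ->
    (forall t : {set W}, (h @: t \in faces D) = (t \in faces E)) ->
  simplicial_iso D E.
Proof.
move=> gK hK hF.
have hv w : w \in vertices E -> h w \in vertices D.
  by rewrite !inE -hF imset_set1.
have gv v : v \in vertices D -> g v \in vertices E.
  by move=> vD; have := vD; rewrite !inE -hF imset_set1 gK.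
pose f (v : {v | v \in vertices D}) : {w | w \in vertices E} :=
  exist _ (g (val v)) (gv _ (valP v)).
exists f; split.
  exists (fun w => exist _ (h (val w)) (hv _ (valP w))) => v; apply: val_inj => /=.
    exact: (gK _ (valP v)).
  exact: (hK _ (valP v)).
move=> s; rewrite -hF -imset_comp; congr (_ \in faces D).
by apply: eq_imset => v /=; exact: (gK _ (valP v)).
Qed.

Lemma join_facesE (V W : finType)
    (D : simplicial_complex V) (E : simplicial_complex W) (t : {set V + W}) :
  (t \in join_faces D E) =
    (inl @^-1: t \in faces D) && (inr @^-1: t \in faces E).
Proof.
apply/imset2P/andP => [[a b aD bE ->]|[tD tE]]; last first.
  exists (inl @^-1: t) (inr @^-1: t) => //; apply/setP => z.
  rewrite inE; apply/idP/orP.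
    by case: z => z zt; [left | right]; apply: imset_f; rewrite inE.
  by case=> /imsetP[y]; rewrite inE => yt ->.
split.
  suff -> : inl @^-1: (inl @: a :|: inr @: b) = a by [].
  apply/setP => x; rewrite !inE mem_imset => [|? ? []//].
  by apply/orb_idr => /imsetP[].
suff -> : inr @^-1: (inl @: a :|: inr @: b) = b by [].
apply/setP => x; rewrite !inE mem_imset => [|? ? []//].
by apply/orb_idl => /imsetP[].
Qed.

(** * Order and lattice operations of the free product *)

Section FreeProductOrder.
Context (d d' : Order.disp_t) (L : finTBLatticeType d) (L' : finTBLatticeType d').
Implicit Types (x : L) (y : L') (w : free_prod L L').

Definition free_fst w : L := if w is Some p then (val p).1 else \top.
Definition free_snd w : L' := if w is Some p then (val p).2 else \top.

(** The adjunction holds for improper pairs too, because a pair below a proper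
    pair is proper and \top has both projections equal to \top. *)
Lemma free_pair_le x y w :
  (free_pair x y <= w) = (x <= free_fst w) && (y <= free_snd w).
Proof.
rewrite /free_pair; case: w => [p|]; last by rewrite /= !lex1.
case: insubP => [q _ qE|np]; rewrite /Order.le /=.
  by rewrite qE.
apply/esym/negbTE; apply: contra np => xyp.
exact: (@proper_pairP _ _ _ _ (x, y)) xyp (valP p).
Qed.

Lemma free_pair_eta w : free_pair (free_fst w) (free_snd w) = w.
Proof.
case: w => [p|]; rewrite /free_pair /=; last by case: insubP => //= ?; rewrite eqxx.
by rewrite -surjective_pairing valK.
Qed.

Lemma free_pair_eq_top x y :
  (free_pair x y == \top) = (x == \top) || (y == \top).
Proof.
rewrite /free_pair; case: insubP => [q /=|/=]; rewrite -negb_or.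
  by move=> /negbTE->.
by move=> /negbNE->; rewrite eqxx.
Qed.

Lemma free_fst_pair x y : x != \top -> y != \top -> free_fst (free_pair x y) = x.
Proof. by move=> nx ny; rewrite /free_pair insubT ?nx. Qed.

Lemma free_snd_pair x y : x != \top -> y != \top -> free_snd (free_pair x y) = y.
Proof. by move=> nx ny; rewrite /free_pair insubT ?nx. Qed.

Lemma free_leE w1 w2 :
  (w1 <= w2) = (free_fst w1 <= free_fst w2) && (free_snd w1 <= free_snd w2).
Proof. by rewrite -{1}(free_pair_eta w1) free_pair_le. Qed.

Lemma free_fstI w1 w2 : free_fst (w1 `&` w2) = free_fst w1 `&` free_fst w2.
Proof.
apply/le_anti; rewrite lexI.
have := leIl w1 w2; have := leIr w2 w1.
rewrite !free_leE => /andP[-> _] /andP[-> _] /=.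
suff: free_pair (free_fst w1 `&` free_fst w2) (free_snd w1 `&` free_snd w2)
    <= w1 `&` w2 by rewrite free_pair_le => /andP[].
by rewrite lexI !free_pair_le !leIl !leIr.
Qed.

Lemma free_sndI w1 w2 : free_snd (w1 `&` w2) = free_snd w1 `&` free_snd w2.
Proof.
apply/le_anti; rewrite lexI.
have := leIl w1 w2; have := leIr w2 w1.
rewrite !free_leE => /andP[_ ->] /andP[_ ->] /=.
suff: free_pair (free_fst w1 `&` free_fst w2) (free_snd w1 `&` free_snd w2)
    <= w1 `&` w2 by rewrite free_pair_le => /andP[].
by rewrite lexI !free_pair_le !leIl !leIr.
Qed.

(** A left adjoint preserves joins. *)
Lemma free_pairU x1 y1 x2 y2 :
  free_pair (x1 `|` x2) (y1 `|` y2) = free_pair x1 y1 `|` free_pair x2 y2.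
Proof.
have le_iff w : (free_pair (x1 `|` x2) (y1 `|` y2) <= w) =
    (free_pair x1 y1 `|` free_pair x2 y2 <= w).
  by rewrite leUx !free_pair_le !leUx andbACA.
by apply/le_anti; rewrite le_iff lexx -le_iff lexx.
Qed.

Definition inj1 x : free_prod L L' := free_pair x \bot.
Definition inj2 y : free_prod L L' := free_pair \bot y.

Lemma join_inj (A : {set L}) (A' : {set L'}) :
  \join_(c in inj1 @: A :|: inj2 @: A') c =
    free_pair (\join_(b in A) b) (\join_(b in A') b).
Proof.
rewrite joins_setU !big_imset_idem /=; try exact: joinxx.
rewrite -[X in free_pair X _]joinx0 -[X in free_pair _ X]join0x free_pairU.
congr (_ `|` _); apply/esym.
  apply: (big_morph inj1) => [x x'|]; last by [].
  by rewrite /inj1 -free_pairU joinxx.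
apply: (big_morph inj2) => [x x'|]; last by [].
by rewrite /inj2 -free_pairU joinxx.
Qed.

End FreeProductOrder.

(** * The boxplus of two building sets *)

Section Boxplus.
Context (d d' : Order.disp_t) (L : finTBLatticeType d) (L' : finTBLatticeType d').
Hypotheses (nt : (\bot : L) != \top) (nt' : (\bot : L') != \top).
Context (B : {set L}) (B' : {set L'}).
Hypotheses (B_gt0 : forall b, b \in B -> \bot < b).
Hypotheses (B'_gt0 : forall b, b \in B' -> \bot < b).
Implicit Types (x : L) (y : L') (w : free_prod L L').

Let i1 := @inj1 _ _ L L'.
Let i2 := @inj2 _ _ L L'.

Lemma mem_boxplus x y :
  (free_pair x y \in boxplus B B') =
  [|| x == \top, y == \top, (x \in B) && (y == \bot) | (x == \bot) && (y \in B')].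
Proof.
rewrite /boxplus in_setU in_set1 free_pair_eq_top orbC -orbA.
case: eqVneq => //= nx; case: eqVneq => //= ny.
rewrite in_setU; congr (_ || _); apply/imsetP/andP => [[b]|].
- rewrite !inE => /andP[nb bB] e.
  have := congr1 (@free_fst _ _ _ _) e; have := congr1 (@free_snd _ _ _ _) e.
  by rewrite !free_snd_pair // !free_fst_pair // => -> ->.
- by move=> [xB /eqP->]; exists x; rewrite // !inE nx.
- rewrite !inE => /andP[nb bB] e.
  have := congr1 (@free_fst _ _ _ _) e; have := congr1 (@free_snd _ _ _ _) e.
  by rewrite !free_snd_pair // !free_fst_pair // => -> ->.
by move=> [/eqP-> yB]; exists y; rewrite // !inE ny.
Qed.

Lemma boxplus_gt0 w : w \in boxplus B B' -> \bot < w.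
Proof.
rewrite lt0x; apply: contraTneq => ->.
rewrite -[\bot]/(free_pair \bot \bot) mem_boxplus !negb_or nt nt' !eqxx andbT /=.
by apply/andP; split; apply/negP; [move/B_gt0 | move/B'_gt0]; rewrite ltxx.
Qed.

Lemma le_inj1 x x' : x' != \top -> (i1 x <= i1 x') = (x <= x').
Proof.
by move=> nx; rewrite /i1 free_pair_le free_fst_pair // le0x andbT.
Qed.

Lemma le_inj2 y y' : y' != \top -> (i2 y <= i2 y') = (y <= y').
Proof. by move=> ny; rewrite /i2 free_pair_le free_snd_pair // le0x. Qed.

Lemma le_inj12 x y : y != \top -> (i1 x <= i2 y) = (x == \bot).
Proof.
by move=> ny; rewrite /i1 free_pair_le free_fst_pair // le0x andbT lex0.
Qed.

Lemma le_inj21 x y : x != \top -> (i2 y <= i1 x) = (y == \bot).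
Proof. by move=> nx; rewrite /i2 free_pair_le free_snd_pair // le0x lex0. Qed.

Lemma maximals_inj (A : {set L}) (A' : {set L'}) :
    {in A, forall x, (x != \bot) && (x != \top)} ->
    {in A', forall y, (y != \bot) && (y != \top)} ->
  maximals (i1 @: A :|: i2 @: A') = i1 @: maximals A :|: i2 @: maximals A'.
Proof.
move=> A_n A'_n; apply/setP => c; rewrite in_setU; apply/maximalsP/orP.
  case=> /setUP[] /imsetP[b bA ->] max; [left|right];
    apply: imset_f; apply/maximalsP; split=> // b' b'A bb'.
    have [/andP[_ nb] /andP[_ nb']] := (A_n _ bA, A_n _ b'A).
    have := congr1 (@free_fst _ _ _ _) (max (i1 b') _ _).
    by rewrite !free_fst_pair //; apply; rewrite ?in_setU ?imset_f ?le_inj1.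
  have [/andP[_ nb] /andP[_ nb']] := (A'_n _ bA, A'_n _ b'A).
  have := congr1 (@free_snd _ _ _ _) (max (i2 b') _ _).
  by rewrite !free_snd_pair //; apply; rewrite ?in_setU ?imset_f ?orbT ?le_inj2.
case=> /imsetP[b /maximalsP[bA max] ->]; (split; first by
  rewrite in_setU imset_f ?orbT) => c' /setUP[] /imsetP[b' b'A ->].
- have /andP[_ nb'] := A_n _ b'A.
  by rewrite le_inj1 // => /(max _ b'A)->.
- have /andP[/negbTE nb _] := A_n _ bA; have /andP[_ nb'] := A'_n _ b'A.
  by rewrite le_inj12 // nb.
- have /andP[/negbTE nb _] := A'_n _ bA; have /andP[_ nb'] := A_n _ b'A.
  by rewrite le_inj21 // nb.
have /andP[_ nb'] := A'_n _ b'A.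
by rewrite le_inj2 // => /(max _ b'A)->.
Qed.

Lemma below_boxplus x y : x != \top -> y != \top ->
  below (boxplus B B') (free_pair x y) = i1 @: below B x :|: i2 @: below B' y.
Proof.
move=> nx ny.
apply/setP => c; rewrite /below in_set [RHS]in_setU; apply/andP/orP.
  rewrite -(free_pair_eta c) mem_boxplus free_pair_le.
  rewrite free_fst_pair // free_snd_pair // => -[+ /andP[cx cy]].
  have /negbTE-> : free_fst c != \top by rewrite -ltx1 (le_lt_trans cx) ?ltx1.
  have /negbTE-> : free_snd c != \top by rewrite -ltx1 (le_lt_trans cy) ?ltx1.
  by rewrite /=; case/orP=> [/andP[cB /eqP->]|/andP[/eqP-> cB]]; [left|right];
    apply: imset_f; rewrite inE cB ?cx ?cy.
case=> /imsetP[b]; rewrite inE => /andP[bB bx] ->.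
  by rewrite mem_boxplus bB eqxx /= !orbT /i1 free_pair_le free_fst_pair // le0x bx.
by rewrite mem_boxplus bB eqxx /= !orbT /i2 free_pair_le free_snd_pair // le0x bx.
Qed.

(** Each coordinate of the target is treated by the splitting of its own factor:
    meets with the other axis have that coordinate \bot. *)
Lemma splits_inj (M : {set L}) (M' : {set L'}) x y :
    x != \top -> y != \top ->
    {in M, forall b, b <= x} -> {in M', forall b, b <= y} ->
    splits M x -> splits M' y ->
  splits (i1 @: M :|: i2 @: M') (free_pair x y).
Proof.
move=> nx ny Mx M'y [s1 s2] [s1' s2'].
have nM b : b \in M -> b != \top.
  by move=> /Mx bx; rewrite -ltx1 (le_lt_trans bx) ?ltx1.
have nM' b : b \in M' -> b != \top.
  by move=> /M'y bx; rewrite -ltx1 (le_lt_trans bx) ?ltx1.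
have inM b : b \in M -> i1 b \in i1 @: M :|: i2 @: M'.
  by move=> bM; rewrite in_setU imset_f.
have inM' b : b \in M' -> i2 b \in i1 @: M :|: i2 @: M'.
  by move=> bM; rewrite in_setU imset_f ?orbT.
split=> [z w|f f_le].
  rewrite [z <= _]free_leE free_fst_pair ?free_snd_pair // => /andP[zx zy] zw.
  rewrite free_leE; apply/andP; split.
    apply: s1 zx _ => b bM; have := zw _ (inM b bM).
    by rewrite free_leE free_fstI free_fst_pair ?nM // => /andP[].
  apply: s1' zy _ => b bM; have := zw _ (inM' b bM).
  by rewrite free_leE free_sndI free_snd_pair ?nM' // => /andP[].
have f1_le b (bM : b \in M) :
    free_fst (f (i1 b)) <= b /\ free_snd (f (i1 b)) <= \bot.
  have := f_le _ (inM b bM).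
  by rewrite free_leE free_fst_pair ?free_snd_pair ?nM // => /andP[].
have f2_le b (bM : b \in M') :
    free_fst (f (i2 b)) <= \bot /\ free_snd (f (i2 b)) <= b.
  have := f_le _ (inM' b bM).
  by rewrite free_leE free_fst_pair ?free_snd_pair ?nM' // => /andP[].
have [b /f1_le[]//|z [zx fz zf]] := s2 (fun b => free_fst (f (i1 b))).
have [b /f2_le[]//|z' [zy fz' zf']] := s2' (fun b => free_snd (f (i2 b))).
have nz : z != \top by rewrite -ltx1 (le_lt_trans zx) ?ltx1.
have nz' : z' != \top by rewrite -ltx1 (le_lt_trans zy) ?ltx1.
exists (free_pair z z'); split=> [|c|c].
- by rewrite free_pair_le free_fst_pair ?free_snd_pair ?zx.
- move=> /setUP[] /imsetP[b bM ->];
    rewrite free_leE free_fst_pair ?free_snd_pair //.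
    by rewrite fz // (le_trans (f1_le b bM).2) ?le0x.
  by rewrite fz' // (le_trans (f2_le b bM).1) ?le0x.
move=> /setUP[] /imsetP[b bM ->]; rewrite free_leE free_fstI free_sndI.
  have nb := nM b bM; rewrite /i1 /inj1 !free_fst_pair // !free_snd_pair //.
  by rewrite zf // meetx0 le0x.
have nb := nM' b bM; rewrite /i2 /inj2 !free_fst_pair // !free_snd_pair //.
by rewrite zf' // meetx0 le0x.
Qed.

Lemma top_boxplus : \top \in boxplus B B'.
Proof. by rewrite /boxplus !in_setU in_set1 eqxx orbT. Qed.

Lemma kappa_boxplus : kappa (boxplus B B') = [set \top].
Proof. exact: top_kappa top_boxplus. Qed.

Lemma boxplus_building :
  building_set B -> building_set B' -> building_set (boxplus B B').
Proof.
move=> hB hB'; apply: building_of_splits boxplus_gt0 _ => Y _.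
rewrite -(free_pair_eta Y); set x := free_fst Y; set y := free_snd Y.
have [|] := boolP (free_pair x y == \top).
  move=> /eqP ->; suff -> : below (boxplus B B') \top = boxplus B B'.
    by rewrite -[maximals _]/(kappa _) kappa_boxplus; exact: splits1.
  by apply/setP => c; rewrite inE lex1 andbT.
rewrite free_pair_eq_top => /norP[nx ny].
rewrite below_boxplus // maximals_inj.
- by apply: splits_inj => // [b /below_le|b /below_le||]; try exact: building_splits.
- move=> b; rewrite inE => /andP[/B_gt0 b0 bx].
  by rewrite -lt0x b0 -ltx1 (le_lt_trans bx) ?ltx1.
move=> b; rewrite inE => /andP[/B'_gt0 b0 bx].
by rewrite -lt0x b0 -ltx1 (le_lt_trans bx) ?ltx1.
Qed.

Definition unsum (v : L + L') : free_prod L L' :=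
  match v with inl x => i1 x | inr y => i2 y end.

Lemma imset_unsum (T : {set L + L'}) :
  unsum @: T = i1 @: (inl @^-1: T) :|: i2 @: (inr @^-1: T).
Proof.
apply/setP => c; rewrite in_setU; apply/imsetP/orP => [[[x|y] vT ->]|].
- by left; apply: imset_f; rewrite inE.
- by right; apply: imset_f; rewrite inE.
by case=> /imsetP[v]; rewrite inE => vT ->; [exists (inl v)|exists (inr v)].
Qed.

Lemma boxplus_inj1 x : (i1 x \in boxplus B B' :\ \top) = (x \in B :\ \top).
Proof.
rewrite in_setD1 mem_boxplus free_pair_eq_top in_setD1 (negbTE nt') orbF.
case: eqVneq => //= nx; rewrite eqxx andbT andbC.
case: (boolP (\bot \in B')) => [/B'_gt0|_]; first by rewrite ltxx.
by rewrite orbF.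
Qed.

Lemma boxplus_inj2 y : (i2 y \in boxplus B B' :\ \top) = (y \in B' :\ \top).
Proof.
rewrite in_setD1 mem_boxplus free_pair_eq_top in_setD1 (negbTE nt).
case: eqVneq => //= ny; rewrite eqxx.
by case: (boolP (\bot \in B)) => [/B_gt0|_]; first by rewrite ltxx.
Qed.

Hypotheses (kB : kappa B = [set \top]) (kB' : kappa B' = [set \top]).

(** From left to right, each axis is an order embedding away from \top that
    carries joins in B, or in B', to joins in the boxplus. From right to left, an
    antichain meeting both axes has a join with both coordinates different from
    \bot and \top, hence outside the boxplus. S and S' may be arbitrary because
    the axes meet the boxplus without its top in exactly the images of B and B'
    without theirs ([boxplus_inj1], [boxplus_inj2]). *)
Lemma nested_boxplus_inj (S : {set L}) (S' : {set L'}) :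
  (i1 @: S :|: i2 @: S' \in nested_faces (boxplus B B')) =
    (S \in nested_faces B) && (S' \in nested_faces B').
Proof.
apply/nested_facesP/andP; rewrite kappa_boxplus.
  case=> /subsetP sub nst.
  have facesS (U : {set free_prod L L'}) : U \subset i1 @: S :|: i2 @: S' ->
      U \in nested_faces (boxplus B B').
    move=> US; apply: nested_faces_sub US _.
    by apply/nested_facesP; rewrite kappa_boxplus; split=> //; apply/subsetP.
  have SB : S \subset B :\ \top.
    by apply/subsetP => x xS; rewrite -boxplus_inj1 sub // in_setU imset_f.
  have SB' : S' \subset B' :\ \top.
    by apply/subsetP => y yS; rewrite -boxplus_inj2 sub // in_setU imset_f ?orbT.
  split; [apply: (nested_faces_preim (j := i1) _ _ _ (facesS _ (subsetUl _ _)))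
         |apply: (nested_faces_preim (j := i2) _ _ _ (facesS _ (subsetUr _ _)))].
  - by rewrite kB.
  - by move=> x x' _ /(subsetP SB)/setD1P[nx' _]; apply: le_inj1.
  - move=> A _ jB; have := join_inj A (set0 : {set L'}).
    rewrite imset0 setU0 => ->.
    by rewrite mem_boxplus jB big_set0 eqxx !orbT.
  - by rewrite kB'.
  - by move=> y y' _ /(subsetP SB')/setD1P[ny' _]; apply: le_inj2.
  move=> A _ jB; have := join_inj (set0 : {set L}) A.
  rewrite imset0 set0U => ->.
  by rewrite mem_boxplus jB big_set0 eqxx !orbT.
case=> Sf Sf'; have [/subsetP SB _] := nested_facesP _ _ Sf.
have [/subsetP SB' _] := nested_facesP _ _ Sf'.
rewrite kB in SB; rewrite kB' in SB'.
split=> [|A AS cA aA].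
  by apply/subsetP => c /setUP[] /imsetP[b bS ->];
    rewrite (boxplus_inj1, boxplus_inj2) (SB, SB').
(* The traces on the axes are cut with S and S' since the axis maps are not
   injective at \top. *)
pose A1 := S :&: i1 @^-1: A; pose A2 := S' :&: i2 @^-1: A.
have nA1 x : x \in A1 -> x != \top by rewrite inE => /andP[/SB/setD1P[]].
have nA2 y : y \in A2 -> y != \top by rewrite inE => /andP[/SB'/setD1P[]].
have defA : A = i1 @: A1 :|: i2 @: A2.
  apply/setP => c; rewrite in_setU; apply/idP/orP => [cA'|].
    have /setUP[] := subsetP AS _ cA' => /imsetP[b bS e]; [left|right];
      by rewrite e imset_f // !inE bS -e.
  by case=> /imsetP[b]; rewrite !inE => /andP[_ bA] ->.
have aA1 : antichain A1.
  rewrite -(@antichain_imset _ _ _ _ i1).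
    by apply: antichainS aA; rewrite defA subsetUl.
  by move=> x x' _ /nA1 nx'; apply: le_inj1.
have aA2 : antichain A2.
  rewrite -(@antichain_imset _ _ _ _ i2).
    by apply: antichainS aA; rewrite defA subsetUr.
  by move=> y y' _ /nA2 ny'; apply: le_inj2.
have [A1S A2S] : A1 \subset S /\ A2 \subset S' by split; exact: subsetIl.
have cA12 : (1 < #|A1| + #|A2|)%N.
  apply: leq_trans cA _; rewrite defA; apply: leq_trans (leq_card_setU _ _) _.
  by apply: leq_add; exact: leq_imset_card.
(* With both joins proper, membership in the boxplus makes one of them \bot. *)
rewrite defA join_inj mem_boxplus.
rewrite (negbTE (face_antichain_top kB Sf A1S aA1 nt)).
rewrite (negbTE (face_antichain_top kB' Sf' A2S aA2 nt')) /=.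
apply/orP => -[/andP[jB /eqP j0]|/andP[/eqP j0 jB]].
  move: cA12; rewrite (face_antichain_bot Sf' A2S B'_gt0 j0) cards0 addn0.
  by rewrite ltnNge (face_antichain_building Sf A1S aA1 jB).
move: cA12; rewrite (face_antichain_bot Sf A1S B_gt0 j0) cards0 add0n.
by rewrite ltnNge (face_antichain_building Sf' A2S aA2 jB).
Qed.

(** The axis of a nonzero element is read off its second coordinate; [unpair] is
    only meaningful on the axes. *)
Definition unpair w : L + L' :=
  if free_snd w == \bot then inl (free_fst w) else inr (free_snd w).

Lemma unsumK (v : L + L') :
  unsum v \in boxplus B B' :\ \top -> unpair (unsum v) = v.
Proof.
rewrite /unpair; case: v => [x|y] /=.
  rewrite boxplus_inj1 => /setD1P[nx _].
  by rewrite free_snd_pair // eqxx free_fst_pair.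
rewrite boxplus_inj2 => /setD1P[ny /B'_gt0]; rewrite lt0x => /negbTE y0.
by rewrite free_snd_pair // y0.
Qed.

Lemma unpairK w : w \in boxplus B B' :\ \top -> unsum (unpair w) = w.
Proof.
rewrite in_setD1 /boxplus !in_setU in_set1; case: eqP => //= _; rewrite orbF.
have E v :
    unsum v \in boxplus B B' :\ \top -> unsum (unpair (unsum v)) = unsum v.
  by move/unsumK->.
case/orP => /imsetP[b bB ->]; first by apply: (E (inl b)); rewrite boxplus_inj1.
by apply: (E (inr b)); rewrite boxplus_inj2.
Qed.

Lemma nested_boxplus_iso :
  simplicial_iso (nested_complex (boxplus B B'))
    (simplicial_join (nested_complex B) (nested_complex B')).
Proof.
have facesE (T : {set L + L'}) : (unsum @: T \in nested_faces (boxplus B B')) =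
    (T \in join_faces (nested_complex B) (nested_complex B')).
  by rewrite imset_unsum nested_boxplus_inj join_facesE.
have vertexP w :
    [set w] \in nested_faces (boxplus B B') -> w \in boxplus B B' :\ \top.
  by case/nested_facesP; rewrite sub1set kappa_boxplus.
apply: (@simplicial_iso_of_maps _ _ _ _ unpair unsum) => [w|v|//].
  by rewrite inE => /vertexP/unpairK.
by rewrite inE /= -facesE imset_set1 => /vertexP/unsumK.
Qed.

End Boxplus.

Lemma connected_nontrivial (d : Order.disp_t) (L : finTBLatticeType d)
    (B : {set L}) :
  building_set B -> connected_building B -> (\bot : L) != \top.
Proof.
move=> hB cB; have [B_gt0 _] := hB; rewrite eq_sym -lt0x; apply: B_gt0.
by apply: (subsetP (kappa_sub B)); rewrite kappa_connected ?inE.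
Qed.

Theorem proposition2p51 (d d' : Order.disp_t)
    (L : finTBLatticeType d) (L' : finTBLatticeType d')
    (B : {set L}) (B' : {set L'})
    (hB : building_set B) (cB : connected_building B)
    (hB' : building_set B') (cB' : connected_building B') :
  building_set (boxplus B B') /\
  connected_building (boxplus B B') /\
  simplicial_iso (nested_complex (boxplus B B'))
    (simplicial_join (nested_complex B) (nested_complex B')).
Proof.
have [[B_gt0 _] [B'_gt0 _]] := (hB, hB').
have nt := connected_nontrivial hB cB; have nt' := connected_nontrivial hB' cB'.
split; first exact: boxplus_building.
split; first by rewrite /connected_building kappa_boxplus cards1.
exact: nested_boxplus_iso (kappa_connected hB cB) (kappa_connected hB' cB').
Qed.
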